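(* Let $j$ and $\nabla_R j$ be bounded on the unit ball of $L^\infty(\Omega)$. Let $(w^n)_n \subset \{ w \in H^1(\Omega) \mid 0 \le w(x) \le 1 \text{ for a.e. } x \in \Omega\}$ be the sequence of iterates produced by the homotopy trust-region algorithm (described in the context), with associated parameters $(\varepsilon^n)_n$. Let $\Delta^0 \ge |\Omega|$. Then there exist $C > 0$ and a subsequence $(w^{n_k})_k$ of $(w^n)_n$ such that $$\sup_{k \in \mathbb{N}} \; j(w^{n_k}) + \gamma E_{\varepsilon^{n_k}}(w^{n_k}) < C < \infty .$$
   Context: $\Omega \subset \mathbb{R}^d$, $d \in \{2,3\}$, is a bounded Lipschitz domain, $|\Omega|$ its Lebesgue measure, and $\gamma > 0$. The function $j : L^2(\Omega)\to\mathbb{R}$ is Fréchet differentiable and $\nabla_R j(w)\in L^2(\Omega)$ is the Riesz representative of $j'(w)$; boundedness of $\nabla_R j$ on the unit ball of $L^\infty(\Omega)$ means $\sup\{\|\nabla_R j(w)\|_{L^2(\Omega)} : \|w\|_{L^\infty(\Omega)}\le 1\}<\infty$. Energy: for $\varepsilon>0$, $E_\varepsilon(w) = \int_\Omega \frac{\varepsilon}{2}|\nabla w|^2 + \frac1\varepsilon \Psi(w)\,\mathrm{d}x$ if $w \in H^1(\Omega)$ and $E_\varepsilon(w) = \infty$ otherwise, where $\Psi(w)(x) = w(x)(1-w(x))$ if $w(x)\in[0,1]$ and $\Psi(w)(x)=\infty$ otherwise. Trust-region subproblems: for $\bar w \in H^1(\Omega)$ with values in $[0,1]$ a.e., $g \in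 L^2(\Omega)$, $\Delta > 0$, both minimize over $w \in L^2(\Omega)$ subject to $\|w-\bar w\|_{L^2(\Omega)}^2 \le \Delta$ and $w(x)\in[0,1]$ for a.e. $x\in\Omega$. - $(\mathrm{TR}_\varepsilon)(\bar w,g,\Delta)$ has objective $(g,w-\bar w)_{L^2(\Omega)} + \gamma E_\varepsilon(w) - \gamma E_\varepsilon(\bar w)$. - $(\mathrm{TR}^c_\varepsilon)(\bar w,g,\Delta)$ has objective $\left(g + \frac{\gamma}{\varepsilon}(1-2\bar w), w-\bar w\right)_{L^2(\Omega)} + \gamma\frac{\varepsilon}{2}\|\nabla w\|_{L^2(\Omega)}^2 - \gamma\frac\varepsilon2\|\nabla\bar w\|_{L^2(\Omega)}^2$ (equal to $+\infty$ for $w \notin H^1(\Omega)$). Reductions: $\operatorname{ared}(w,v,\varepsilon) = j(w)+\gamma E_\varepsilon(w) - j(v) - \gamma E_\varepsilon(v)$; $\operatorname{pred}(w,\Delta,\varepsilon)$ is minus the minimal objective value of $(\mathrm{TR}^c_\varepsilon)(w,\nabla_R j(w),\Delta)$ if flag $=1$, and minus the minimal objective value of $(\mathrm{TR}_\varepsilon)(w,\nabla_R j(w),\Delta)$ if flag $=0$. Homotopy trust-region algorithm. Inputs: $\rho\in(0,1)$, $\Delta^0>0$, $\varepsilon^0>0$, $r>4$, $0<\kappa^0<\rho$, $\underline\Delta^0\in(0,\Delta^0)$, $w^0\in H^1(\Omega)$ with values in $\{0,1\}$ a.e. Set flag $=1$. For $n=0,1,2,\dots$: (1) If flag $=1$,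 let $\tilde w^n$ be a minimizer of $(\mathrm{TR}^c_{\varepsilon^n})(w^n,\nabla_R j(w^n),\Delta^n)$; otherwise let $\tilde w^n$ be a minimizer of $(\mathrm{TR}_{\varepsilon^n})(w^n,\nabla_R j(w^n),\Delta^n)$. (2) If $\operatorname{ared}(w^n,\tilde w^n,\varepsilon^n)\ge\rho\operatorname{pred}(w^n,\Delta^n,\varepsilon^n)$ and $\operatorname{ared}(w^n,\tilde w^n,\varepsilon^n)>\kappa^n\underline\Delta^n$ (acceptance), set $w^{n+1}=\tilde w^n$, $\Delta^{n+1}=\min\{\Delta^0,2\Delta^n\}$, flag $=1$. Otherwise set $w^{n+1}=w^n$, $\Delta^{n+1}=\Delta^n/2$. (3) If $\Delta^{n+1}<\underline\Delta^n$ and flag $=1$: set flag $=0$, reset $\Delta^{n+1}=\Delta^0$, and keep $\underline\Delta^{n+1}=\underline\Delta^n$, $\varepsilon^{n+1}=\varepsilon^n$, $\kappa^{n+1}=\kappa^n$. Else if $\Delta^{n+1}<\underline\Delta^n$: set flag $=1$, $\Delta^{n+1}=\Delta^0$, $\underline\Delta^{n+1}=\underline\Delta^n/2$, $\varepsilon^{n+1}=\varepsilon^n/r$, $\kappa^{n+1}=\kappa^n/2$. Otherwise keep $\underline\Delta^{n+1}=\underline\Delta^n$, $\varepsilon^{n+1}=\varepsilon^n$, $\kappa^{n+1}=\kappa^n$. *)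

(* Defs.v *)
From HB Require Import structures.
From mathcomp Require Import all_boot all_order all_algebra.
From mathcomp Require Import all_classical all_reals all_analysis.
From mathcomp Require Import measurable_realfun ess_sup_inf.
Set Implicit Arguments.
Unset Strict Implicit.
Unset Printing Implicit Defensive.
Import Order.TTheory GRing.Theory Num.Theory.
Import numFieldNormedType.Exports.
Local Open Scope classical_set_scope.
Local Open Scope ring_scope.

(* The product sigma-algebra on R^d, as for n.-tuple T in the library; it is
   the Borel one, see [measurable_rVE]. *)
Definition measure_rV_display : measure_display -> measure_display.
Proof. exact. Qed.

Section measurable_rV.
Context {R : realType} {d : nat}.

Let coors : 'I_d -> 'rV[R]_d -> measurableTypeR R := fun i x => x ord0 i.

Let rV_set0 : g_sigma_preimage coors set0.
Proof. exact: sigma_algebra0. Qed.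

Let rV_setC A : g_sigma_preimage coors A -> g_sigma_preimage coors (~` A).
Proof. exact: sigma_algebraC. Qed.

Let rV_bigcup (F : _^nat) : (forall i, g_sigma_preimage coors (F i)) ->
  g_sigma_preimage coors (\bigcup_i (F i)).
Proof. exact: sigma_algebra_bigcup. Qed.

HB.instance Definition _ := @isMeasurable.Build
  (measure_rV_display (R.-ocitv.-measurable).-sigma)
  ('rV[R]_d) (g_sigma_preimage coors) rV_set0 rV_setC rV_bigcup.

End measurable_rV.


Section measurable_rV_theory.
Context {R : realType}.

Lemma measurable_rV_coord d (i : 'I_d) :
  measurable_fun [set: 'rV[R]_d] (fun x => x ord0 i : measurableTypeR R).
Proof.
move=> _ Y mY; apply: sub_sigma_algebra; rewrite -bigcup_seq/=.
exists i; first exact: mem_index_enum.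
by exists Y.
Qed.

Lemma measurable_fun_rVP d0 (T : measurableType d0) d (f : T -> 'rV[R]_d) :
  (forall i, measurable_fun [set: T] (fun t => f t ord0 i : measurableTypeR R)) ->
  measurable_fun [set: T] f.
Proof.
move=> mf _ A; rewrite setTI.
pose S := [set A : set 'rV[R]_d | measurable (f @^-1` A)].
suff: measurable `<=` S by apply.
apply: smallest_sub.
  split=> [|B SB|F SF]; rewrite /S/=.
  - by rewrite preimage_set0.
  - by rewrite setTD preimage_setC; exact: measurableC.
  - by rewrite preimage_bigcup; exact: bigcupT_measurable.
move=> B; rewrite -bigcup_seq => -[i _ [Y mY <-]]; rewrite /S/= setTI.
by have := mf i measurableT Y mY; rewrite setTI.
Qed.

Lemma measurable_ball_rV d (q : 'rV[R]_d) (e : R) : measurable (ball q e).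
Proof.
have [e0|e0] := ltP 0 e; last by rewrite le0_ball0.
rewrite (_ : ball q e =
   \bigcap_(i in [set: 'I_d]) (fun x : 'rV[R]_d => x ord0 i) @^-1` ball (q ord0 i) e).
  apply: fin_bigcap_measurable => // i _.
  have := @measurable_rV_coord d i measurableT (ball (q ord0 i) e).
  by rewrite setTI; apply; exact: measurable_ball.
apply/seteqP; split=> x.
  by move=> [_ qx] i _; exact: qx.
by move=> qx; split=> // i j; rewrite (ord1 i); exact: qx.
Qed.

Lemma open_measurable_rV d (U : set 'rV[R]_d) : open U -> measurable U.
Proof.
move=> oU.
pose B (qk : 'rV[rat]_d * nat) : set 'rV[R]_d :=
  ball (\row_i (ratr (qk.1 ord0 i) : R)) qk.2.+1%:R^-1.
rewrite (_ : U = \bigcup_(qk in [set qk | B qk `<=` U]) B qk).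
  rewrite bigcup_mkcond; apply: countable_bigcupT_measurable => // qk.
  by case: ifPn => // _; exact: measurable_ball_rV.
apply/seteqP; split=> [x Ux|x [qk BU Bx]]; last exact: BU.
have /nbhs_ballP[e /= e0 xeU] : nbhs x U by exact: open_nbhs_nbhs.
have [k ke] : exists k, k.+1%:R^-1 < e / 2 :> R.
  by exists (Num.trunc (e / 2)^-1); rewrite invf_plt ?posrE ?divr_gt0// truncnS_gt.
have k0 : 0 < k.+1%:R^-1 :> R by rewrite invr_gt0.
have H i : {q : rat | ball (x ord0 i) k.+1%:R^-1 (ratr q : R)}.
  apply: cid; have [||y [By [q _ qy]]] := @dense_rat R (ball (x ord0 i) k.+1%:R^-1).
  - by exists (x ord0 i); exact: ballxx.
  - exact: ball_open.
  - by exists q; rewrite qy.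
exists (\row_i sval (H i), k); last first.
  split=> //= a i; rewrite (ord1 a) !mxE; apply: ball_sym; exact: (svalP (H i)).
move=> y [_ By]; apply: xeU.
split=> // a i; rewrite (ord1 a).
have := By ord0 i; rewrite !mxE /= => /(ball_triangle (svalP (H i))).
by apply: le_ball; rewrite [leRHS](splitr e) lerD// ltW.
Qed.

Lemma measurable_rVE d :
  @measurable _ 'rV[R]_d = <<s [set U : set 'rV[R]_d | open U] >>.
Proof.
apply/seteqP; split; last first.
  apply: smallest_sub; first exact: sigma_algebra_measurable.
  by move=> U; exact: open_measurable_rV.
apply: smallest_sub; first exact: smallest_sigma_algebra.
move=> A; rewrite -bigcup_seq => -[i _ [Y mY <-]]; rewrite setTI.
pose S := [set Y : set R |
  <<s [set U : set 'rV[R]_d | open U] >> ((fun x : 'rV[R]_d => x ord0 i) @^-1` Y)].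
suff: @measurable _ (measurableTypeR R) `<=` S by exact.
rewrite (@RGenOpens.measurableE R); apply: smallest_sub.
  split=> [|B SB|F SF]; rewrite /S /mkset.
  - by rewrite preimage_set0; exact: sigma_algebra0.
  - by rewrite setTD preimage_setC -setTD; exact: sigma_algebraCD.
  - by rewrite preimage_bigcup; exact: sigma_algebra_bigcup.
move=> _ [a [b ->]]; apply: sub_sigma_algebra => /=.
apply: open_comp; last exact: interval_open.
by move=> x _; exact: coord_continuous.
Qed.

End measurable_rV_theory.

Section pushforward_sigma_finite.
Context d1 d2 (T1 : measurableType d1) (T2 : measurableType d2) (R : realType).
Variables (m : {measure set T1 -> \bar R}) (f : T1 -> T2).
Variables (g : T2 -> T1) (mf : measurable_fun [set: T1] f).
Hypotheses (m_sf : sigma_finite [set: T1] m)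
  (mg : measurable_fun [set: T2] g) (fK : cancel f g).

Let nu := pushforward m f.

Let nuM : {measure set T2 -> \bar R} :=
  measure_function_pushforward__canonical__measure_function_Measure m mf.

HB.instance Definition _ := isMeasure.Build _ _ _ nu
  (measure0 nuM) (measure_ge0 nuM) (@measure_semi_sigma_additive _ _ _ nuM).

Let nu_sigma_finite : sigma_finite setT nu.
Proof.
have [F FT Ffin] := m_sf.
exists (fun n => g @^-1` F n) => [|n].
  by rewrite -preimage_bigcup -FT preimage_setT.
have [mFn Fn] := Ffin n; split; first by rewrite -[X in measurable X]setTI; exact: mg.
rewrite /nu /pushforward (_ : f @^-1` _ = F n)//.
by apply/seteqP; split=> x /=; rewrite fK.
Qed.

HB.instance Definition _ := Measure_isSigmaFinite.Build _ _ _ nu nu_sigma_finite.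

Lemma pushforward_sigma_finite :
  {mu : {sigma_finite_measure set T2 -> \bar R} |
    mu = pushforward m f :> (set T2 -> \bar R)}.
Proof. by exists nu. Qed.

End pushforward_sigma_finite.

(* Lebesgue measure on R^d as an iterated product measure, through the
   identification of R * R^d with R^(d+1). *)
Section lebesgue_rV.
Context {R : realType}.

Definition cons_rV d (p : measurableTypeR R * 'rV[R]_d) : 'rV[R]_d.+1 :=
  \row_i (if unlift ord0 i is Some j then p.2 ord0 j else p.1).

Fixpoint lebesgue_rV d : set 'rV[R]_d -> \bar R :=
  if d is d'.+1 then
    pushforward (lebesgue_measure \x @lebesgue_rV d')%E (@cons_rV d')
  else \d_(0 : 'rV[R]_0).

Lemma measurable_cons_rV d : measurable_fun [set: _] (@cons_rV d).
Proof.
apply: measurable_fun_rVP => i.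
rewrite /cons_rV; under eq_fun do rewrite mxE.
case: (unlift ord0 i) => [j|]; last exact: measurable_fst.
apply: (measurableT_comp (@measurable_rV_coord R d j)); exact: measurable_snd.
Qed.

Lemma lebesgue_rV_sigma_finite_measure d :
  {mu : {sigma_finite_measure set 'rV[R]_d -> \bar R} |
    mu = @lebesgue_rV d :> (set 'rV[R]_d -> \bar R)}.
Proof.
elim: d => [|d [mu mE]]; first by exists (\d_(0 : 'rV[R]_0)).
rewrite /= -mE; pose uncons (x : 'rV[R]_d.+1) : measurableTypeR R * 'rV[R]_d :=
  (x ord0 ord0, \row_j x ord0 (lift ord0 j)).
pose m : {measure set (measurableTypeR R * 'rV[R]_d)%type -> \bar R} :=
  (lebesgue_measure \x mu)%E.
apply: (@pushforward_sigma_finite _ _ _ _ _ m (@cons_rV d) uncons).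
- exact: measurable_cons_rV.
- have /sigma_finiteP[F [TF ndF Foo]] := sigma_finiteT (@lebesgue_measure R).
  have /sigma_finiteP[G [TG ndG Goo]] := sigma_finiteT mu.
  exists (fun n => F n `*` G n).
    rewrite -setXTT TF TG; apply/seteqP; split=> [[x y] [/= [n _ Fnx] [k _ Gky]]|].
      exists (maxn n k) => //; split.
        by move: x Fnx; exact/subsetPset/ndF/leq_maxl.
      by move: y Gky; exact/subsetPset/ndG/leq_maxr.
    by move=> [x y] [n _ []/= ? ?]; split; exists n.
  move=> k; have [? ?] := Foo k; have [? ?] := Goo k.
  split; first exact: measurableX.
  by rewrite /m/= product_measure1E// lte_mul_pinfty// ge0_fin_numE.
- apply: measurable_fun_pair; first exact: measurable_rV_coord.
  apply: measurable_fun_rVP => i; under eq_fun do rewrite mxE.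
  exact: measurable_rV_coord.
- move=> [a x]; rewrite /uncons /cons_rV mxE unlift_none; congr pair.
  by apply/rowP => i; rewrite !mxE liftK.
Qed.

Let leb0 d : @lebesgue_rV d set0 = 0%E.
Proof. by case: (lebesgue_rV_sigma_finite_measure d) => mu <-; exact: measure0. Qed.

Let leb_ge0 d A : (0 <= @lebesgue_rV d A)%E.
Proof. by case: (lebesgue_rV_sigma_finite_measure d) => mu <-; exact: measure_ge0. Qed.

Let leb_sigma_additive d : semi_sigma_additive (@lebesgue_rV d).
Proof.
case: (lebesgue_rV_sigma_finite_measure d) => mu <-.
exact: measure_semi_sigma_additive.
Qed.

HB.instance Definition _ d := isMeasure.Build _ _ _ (@lebesgue_rV d)
  (@leb0 d) (@leb_ge0 d) (@leb_sigma_additive d).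

Let leb_sigma_finite d : sigma_finite setT (@lebesgue_rV d).
Proof.
case: (lebesgue_rV_sigma_finite_measure d) => mu <-; exact: sigma_finiteT.
Qed.

HB.instance Definition _ d := Measure_isSigmaFinite.Build _ _ _ (@lebesgue_rV d)
  (@leb_sigma_finite d).

Lemma lebesgue_rV_box d (A : 'I_d -> set (measurableTypeR R)) :
  (forall i, measurable (A i)) ->
  @lebesgue_rV d [set x | forall i, A i (x ord0 i)] =
  (\prod_(i < d) lebesgue_measure (A i))%E.
Proof.
elim: d A => [|d IH] A mA.
  rewrite big_ord0 /= /dirac indicE mem_set//= => -[].
  by [].
rewrite big_ord_recl -IH//= /pushforward.
pose B := [set x : 'rV[R]_d | forall i, A (lift ord0 i) (x ord0 i)].
have -> : @cons_rV d @^-1` [set x | forall i, A i (x ord0 i)] = A ord0 `*` B.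
  apply/seteqP; split=> [[a x] /= H|[a x] [/= Aa Bx] i].
    split=> [|i] /=; first by have := H ord0; rewrite mxE unlift_none.
    by have := H (lift ord0 i); rewrite mxE liftK.
  by rewrite mxE; case: unliftP => [k ->|->//]; exact: Bx.
rewrite (@product_measure1E _ _ _ _ _ lebesgue_measure (@lebesgue_rV d))//.
rewrite (_ : B = \bigcap_(i in [set: 'I_d])
    ((fun x : 'rV[R]_d => x ord0 i) @^-1` A (lift ord0 i))).
  apply: fin_bigcap_measurable => // i _.
  by rewrite -[X in measurable X]setTI; exact: measurable_rV_coord.
by apply/seteqP; split=> x /= H i; [move=> _; exact: H|exact: H].
Qed.

End lebesgue_rV.

(* Near each boundary point, in the orthonormal coordinates y = (x - p) Q, the
   set is the region above the graph of a Lipschitz function of the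
   coordinates other than y_i. *)
Definition lipschitz_boundary (R : realType) (d : nat) (Omega : set 'rV[R]_d) :=
  forall p, (closure Omega `\` Omega) p ->
  exists (Q : 'M[R]_d) (i : 'I_d) (g : 'rV[R]_d.-1 -> R) (L r : R),
    [/\ Q *m Q^T = 1%:M, L.-lipschitz g, 0 < r &
      forall x, ball p r x ->
        Omega x <-> g (col' i ((x - p) *m Q)) < ((x - p) *m Q) ord0 i].

Record lipschitz_domain (R : realType) (d : nat) := LipschitzDomain {
  domain_set :> set 'rV[R]_d ;
  domain_open : open domain_set ;
  domain_connected : connected domain_set ;
  domain_nonempty : domain_set !=set0 ;
  domain_bounded : bounded_set domain_set ;
  domain_lipschitz : lipschitz_boundary domain_set }.

Section smooth_functions.
Context {R : realType} {d : nat}.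
Implicit Types phi : 'rV[R]_d -> R.

Definition partial (i : 'I_d) phi : 'rV[R]_d -> R :=
  fun x => 'D_(delta_mx ord0 i) phi x.

Definition smooth phi := forall s : seq 'I_d,
  let psi := foldr partial phi s in
  continuous psi /\ forall i x, derivable psi x (delta_mx ord0 i).

Definition support phi := closure [set x | phi x != 0].

Definition test_function (Omega : set 'rV[R]_d) phi :=
  [/\ smooth phi, compact (support phi) & support phi `<=` Omega].

End smooth_functions.

Section function_spaces.
Context {R : realType} {d : nat} (Omega : lipschitz_domain R d).

(* Lebesgue measure restricted to Omega: functions on Omega are represented by
   functions on R^d whose values outside Omega are irrelevant. *)
Definition domain_measure : {measure set 'rV[R]_d -> \bar R} :=
  mrestr (@lebesgue_rV R d) (open_measurable_rV (@domain_open _ _ Omega)).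
Local Notation mu := domain_measure.

(* Square-integrable functions, not quotiented by a.e. equality. *)
Definition L2 := LfunType mu (lee1n 2).

Definition L2norm (f : L2) : R := fine ('N[mu]_2%:E[EFin \o f])%E.

Definition dotL2 (f g : 'rV[R]_d -> R) : R := \int[mu]_x (f x * g x).

Definition is_weak_gradient (w : L2) (G : {ffun 'I_d -> L2}) :=
  forall phi, test_function Omega phi -> forall i,
    \int[mu]_x (w x * partial i phi x) = - \int[mu]_x (G i x * phi x).

Definition H1 : set L2 := [set w | exists G, is_weak_gradient w G].

(* The weak gradient, unique up to a.e. equality. *)
Definition weak_gradient (w : L2) : {ffun 'I_d -> L2} :=
  xget [ffun=> 0] (is_weak_gradient w).

Definition sqr_grad (w : L2) (x : 'rV[R]_d) : R :=
  \sum_(i < d) (weak_gradient w i x) ^+ 2.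

Definition Psi (t : R) : \bar R :=
  if 0 <= t <= 1 then (t * (1 - t))%:E else +oo%E.

Definition energy (eps : R) (w : L2) : \bar R :=
  if `[< H1 w >] then
    (\int[mu]_x ((eps / 2 * sqr_grad w x)%:E + eps^-1%:E * Psi (w x)))%E
  else +oo%E.

(* That j is a function of the class of w; this also follows from the Frechet
   differentiability of j for the seminorm L2norm. *)
Definition L2_invariant (j : L2 -> R) :=
  forall u v : L2, u = v %[ae mu] -> j u = j v.

Definition frechet_derivative (j : L2 -> R) (w : L2) (A : L2 -> R) :=
  [/\ scalar A,
      exists M, forall h, `|A h| <= M * L2norm h &
      forall e, 0 < e -> exists2 delta, 0 < delta &
        forall h, L2norm h < delta ->
          `|j (w + h) - j w - A h| <= e * L2norm h].

Definition is_riesz_gradient (j : L2 -> R) (gradj : L2 -> L2) :=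
  forall w, frechet_derivative j w (fun h => dotL2 (gradj w) h).

Definition Linfty_unit_ball : set L2 :=
  [set w | ('N[mu]_+oo[EFin \o w] <= 1)%E].

End function_spaces.

Section homotopy_trust_region.
Context {R : realType} {d : nat} {Omega : lipschitz_domain R d}.
Local Notation mu := (domain_measure Omega).
Local Notation L2 := (L2 Omega).
Implicit Types (w v g : L2) (gamma eps Delta rho : R) (flag : bool).

Definition dirichlet w : \bar R :=
  if `[< H1 w >] then (\int[mu]_x (sqr_grad w x)%:E)%E else +oo%E.

Definition tr_feasible (wbar : L2) Delta : set L2 :=
  [set w | L2norm (w - wbar) ^+ 2 <= Delta /\
           {ae mu, forall x, 0 <= w x <= 1}].

Definition tr_objective gamma eps (wbar g w : L2) : \bar R :=
  ((dotL2 Omega g (w - wbar))%:E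
    + gamma%:E * energy eps w - gamma%:E * energy eps wbar)%E.

Definition trc_objective gamma eps (wbar g w : L2) : \bar R :=
  ((dotL2 Omega (fun x => g x + gamma / eps * (1 - 2 * wbar x)) (w - wbar))%:E
    + (gamma * (eps / 2))%:E * dirichlet w
    - (gamma * (eps / 2))%:E * dirichlet wbar)%E.

Definition subproblem_objective flag gamma eps (wbar g w : L2) : \bar R :=
  if flag then trc_objective gamma eps wbar g w
  else tr_objective gamma eps wbar g w.

Definition subproblem_minimizer flag gamma eps (wbar g : L2) Delta w :=
  tr_feasible wbar Delta w /\
  forall v, tr_feasible wbar Delta v ->
    (subproblem_objective flag gamma eps wbar g w <=
     subproblem_objective flag gamma eps wbar g v)%E.

Definition subproblem_value flag gamma eps (wbar g : L2) Delta : \bar R :=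
  ereal_inf [set subproblem_objective flag gamma eps wbar g v |
             v in tr_feasible wbar Delta].

Definition ared (j : L2 -> R) gamma w v eps : \bar R :=
  ((j w)%:E + gamma%:E * energy eps w - (j v)%:E - gamma%:E * energy eps v)%E.

Definition pred_reduction (gradj : L2 -> L2) gamma flag w Delta eps : \bar R :=
  (- subproblem_value flag gamma eps w (gradj w) Delta)%E.

Record state := State {
  st_w : L2 ;
  st_Delta : R ;
  st_minDelta : R ;
  st_eps : R ;
  st_kappa : R ;
  st_flag : bool }.

Definition accepted j gradj gamma rho (s : state) (wt : L2) : Prop :=
  let a := ared j gamma (st_w s) wt (st_eps s) in
  (rho%:E * pred_reduction gradj gamma (st_flag s) (st_w s) (st_Delta s) (st_eps s)
     <= a)%E /\
  ((st_kappa s * st_minDelta s)%:E < a)%E.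

Definition next_state j gradj gamma rho Delta0 r (s : state) (wt : L2) : state :=
  let: State w Delta minDelta eps kappa flag := s in
  let acc := `[< accepted j gradj gamma rho s wt >] in
  let w' := if acc then wt else w in
  let Delta' := if acc then Num.min Delta0 (2 * Delta) else Delta / 2 in
  let flag' := acc || flag in
  if Delta' < minDelta then
    if flag' then State w' Delta0 minDelta eps kappa false
    else State w' Delta0 (minDelta / 2) (eps / r) (kappa / 2) true
  else State w' Delta' minDelta eps kappa flag'.

(* Minimizers of the subproblems need not be unique, so that the algorithm
   determines a transition relation rather than a function. *)
Definition algorithm_step j gradj gamma rho Delta0 r (s s' : state) : Prop :=
  exists2 wt,
    subproblem_minimizer (st_flag s) gamma (st_eps s) (st_w s)
      (gradj (st_w s)) (st_Delta s) wt &
    s' = next_state j gradj gamma rho Delta0 r s wt.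

Definition algorithm_run j gradj gamma rho Delta0 minDelta0 eps0 kappa0 r
    (w0 : L2) (s : nat -> state) : Prop :=
  s 0%N = State w0 Delta0 minDelta0 eps0 kappa0 true /\
  forall n, algorithm_step j gradj gamma rho Delta0 r (s n) (s n.+1).

End homotopy_trust_region.

(* Main.v *)
Require Import Defs.
From mathcomp Require Import all_boot all_order all_algebra.
From mathcomp Require Import all_classical all_reals all_analysis.
From mathcomp Require Import measurable_realfun ess_sup_inf lra.
Set Implicit Arguments.
Unset Strict Implicit.
Unset Printing Implicit Defensive.
Import Order.TTheory GRing.Theory Num.Theory.
Import numFieldNormedType.Exports.
Local Open Scope classical_set_scope.
Local Open Scope ring_scope.

(** Write J_n for the merit value j(w^n) + gamma E_(eps^n)(w^n).

    As long as eps is unchanged, J_n cannot increase: an accepted step has a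
    positive actual reduction, and a rejected one keeps the iterate
    ([ared_gt0]). The only danger is a decrease of eps, which may raise the
    energy without any control in terms of its previous value.

    Before eps decreases, the exact subproblem (flag = 0) must have been tried,
    and rejected, at the iterate concerned with every radius from Delta0
    downwards. As Delta0 >= |Omega|, the constraint with radius Delta0 is void
    on [0,1]-valued functions, so that the first of these attempts computes a
    global minimizer of the objective with j linearized. The actual and the predicted
    reductions differ only by the linearization error of j, which is bounded
    uniformly because j and its gradient are bounded on the unit ball of
    L^infty and Omega has finite measure. A rejection therefore bounds the
    predicted reduction, whatever eps is. Comparing the minimizer with the
    initial function w0, whose energy is (eps/2) times its Dirichlet integral
    since it takes its values in {0,1}, bounds J_n by a constant C that does
    not depend on n ([energy_binary], [rejected_merit_le]).

    Hence at each n either J_n <= C or J_(n+1) <= J_n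
    ([algorithm_step_merit]). If J_n <= C for infinitely many n, these n give
    the subsequence; otherwise J is eventually nonincreasing and a tail of the
    sequence will do ([bounded_subsequence]). *)

(** * Square-integrable functions with values in the unit interval *)

Section function_space_facts.
Context {R : realType} {d : nat} (Omega : lipschitz_domain R d).
Local Notation mu := (domain_measure Omega).
Implicit Types u v w f g : L2 Omega.

Definition unit_valued w := {ae mu, forall x, 0 <= w x <= 1}.

Lemma unit_valued_Linfty w : unit_valued w -> Linfty_unit_ball w.
Proof.
move=> w01; rewrite /Linfty_unit_ball /= unlock /Lnorm.
case: ifPn => _; last exact: lee01.
apply/ess_supP; apply: filterS w01 => x /andP[w0 w1] /=.
by rewrite lee_fin ger0_norm.
Qed.

Lemma L2_Lfun f : (f : _ -> R) \in Lfun mu 2%:E.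
Proof.
rewrite inE; apply/andP; split; rewrite inE /=; first exact: measurable_funPT.
exact: Lfunction_finite.
Qed.

Lemma L2norm_ge0 f : 0 <= L2norm f.
Proof. by apply: fine_ge0; exact: Lnorm_ge0. Qed.

Lemma L2normE f : (L2norm f)%:E = ('N[mu]_2%:E[EFin \o f])%E.
Proof. exact: finite_norm_fine. Qed.

Lemma sqr_L2norm f : (L2norm f ^+ 2)%:E = (\int[mu]_x (f x ^+ 2)%:E)%E.
Proof.
rewrite -powR_mulrn ?L2norm_ge0// -poweR_EFin L2normE poweR_Lnorm ?pnatr_eq0//.
by apply: eq_integral => x _ /=; rewrite powR_mulrn// -normrX ger0_norm// sqr_ge0.
Qed.

Lemma domain_measure_setT : mu setT = lebesgue_rV (Omega : set 'rV[R]_d).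
Proof. by rewrite -[in RHS](setTI (Omega : set _)). Qed.

(** The trust-region constraint with a radius at least |Omega| does not exclude
    any [0,1]-valued function. *)
Lemma unit_valued_dist u v Delta :
  (lebesgue_rV (Omega : set 'rV[R]_d) <= Delta%:E)%E ->
  unit_valued u -> unit_valued v -> L2norm (u - v) ^+ 2 <= Delta.
Proof.
move=> OD u01 v01; rewrite -lee_fin sqr_L2norm; apply: le_trans OD.
rewrite -domain_measure_setT -[leRHS]mul1e -integral_cst//.
apply: ae_ge0_le_integral => //.
- by move=> x _; rewrite lee_fin sqr_ge0.
- by apply/measurable_EFinP; apply: measurable_funX.
- near=> x => _.
  have /andP[? ?] : 0 <= u x <= 1 by near: x.
  have /andP[? ?] : 0 <= v x <= 1 by near: x.
  rewrite lee_fin; have -> : (u - v : L2 Omega) x = u x - v x by [].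
  by nra.
Unshelve. all: by end_near. Qed.

Lemma Cauchy_Schwarz f g : `|dotL2 Omega f g| <= L2norm f * L2norm g.
Proof.
have fgL1 : (f \* g)%R \in Lfun mu 1.
  by apply: Lfun2_mul_Lfun1; exact: L2_Lfun.
have fgi : mu.-integrable setT (EFin \o (f \* g)%R) by exact/Lfun1_integrable.
apply: le_trans (le_normr_Rintegral _ fgi) _ => //.
rewrite -lee_fin EFinM !L2normE /Rintegral fineK; last first.
  exact/integrable_fin_num/integrable_norm.
have := @hoelder _ _ _ mu f g 2 2.
rewrite Lnorm1; apply => //.
by rewrite [RHS]splitr !div1r.
Qed.

(** * Finiteness and monotonicity in eps of the energy *)

Lemma Psi_ge0 (t : R) : (0 <= Psi t)%E.
Proof.
rewrite /Psi; case: ifP => // /andP[t0 t1].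
by rewrite lee_fin mulr_ge0// subr_ge0.
Qed.

Lemma sqr_grad_ge0 w x : 0 <= sqr_grad w x.
Proof. by apply: sumr_ge0 => i _; exact: sqr_ge0. Qed.

Lemma energy_ge0 eps w : 0 < eps -> (0 <= energy eps w)%E.
Proof.
move=> e0; rewrite /energy; case: ifP => // _.
apply: integral_ge0 => x _; apply: adde_ge0.
  by rewrite lee_fin mulr_ge0 ?sqr_grad_ge0// divr_ge0 ?ltW.
by rewrite mule_ge0 ?Psi_ge0// lee_fin invr_ge0 ltW.
Qed.

Lemma measurable_Psi : measurable_fun setT (@Psi R).
Proof.
apply: measurable_fun_ifT => //.
  rewrite (_ : (fun t : R => _) = (fun t => (0 <= t) && (t <= 1)))//.
  by apply: measurable_and; apply: measurable_fun_ler.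
by apply/measurable_EFinP; apply: measurable_funM => //; apply: measurable_funB.
Qed.

Lemma integrable_sqr_grad w : mu.-integrable setT (EFin \o sqr_grad w).
Proof.
rewrite (_ : EFin \o _ =
  (fun x => \sum_(i < d) ((weak_gradient w i x) ^+ 2)%:E)%E); last first.
  by apply/funext => x /=; rewrite sumEFin.
apply: integrable_sum => // i _.
by apply: Lfun2_integrable_sqr; exact: L2_Lfun.
Qed.

Lemma energy_density_ge0 eps w x : 0 < eps ->
  (0 <= (eps / 2 * sqr_grad w x)%:E + eps^-1%:E * Psi (w x))%E.
Proof.
move=> e0; apply: adde_ge0.
  by rewrite lee_fin mulr_ge0 ?sqr_grad_ge0// divr_ge0 ?ltW.
by rewrite mule_ge0 ?Psi_ge0// lee_fin invr_ge0 ltW.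
Qed.

Lemma measurable_sqr_grad w : measurable_fun setT (EFin \o sqr_grad w).
Proof. by case/integrableP: (integrable_sqr_grad w). Qed.

Lemma measurable_energy_density eps w : measurable_fun setT
  (fun x => (eps / 2 * sqr_grad w x)%:E + eps^-1%:E * Psi (w x))%E.
Proof.
apply: emeasurable_funD.
  apply/measurable_EFinP; apply: measurable_funM => //.
  by apply/measurable_EFinP; exact: measurable_sqr_grad.
by apply: measurable_funeM; apply: measurableT_comp => //; exact: measurable_Psi.
Qed.

Lemma energy_fin_H1 eps w : energy eps w \is a fin_num -> H1 w.
Proof. by rewrite /energy; case: asboolP. Qed.

(** Membership in H^1 and in [0,1] is independent of eps, so this keeps the
    energy of an iterate finite when eps changes. *)
Lemma energy_fin_num eps w : (mu setT < +oo)%E -> 0 < eps -> H1 w ->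
  unit_valued w -> energy eps w \is a fin_num.
Proof.
move=> mufin e0 Hw w01; rewrite ge0_fin_numE ?energy_ge0// /energy asboolT//.
have e2 : 0 <= eps / 2 by rewrite divr_ge0 ?ltW.
apply: (@le_lt_trans _ _
    (\int[mu]_x ((eps / 2)%:E * (sqr_grad w x)%:E + eps^-1%:E)%E)%E).
  apply: ae_ge0_le_integral => //.
  - by move=> x _; exact: energy_density_ge0.
  - exact: measurable_energy_density.
  - move=> x _; rewrite adde_ge0// ?lee_fin ?invr_ge0 ?(ltW e0)//.
    by rewrite mulr_ge0 ?sqr_grad_ge0.
  - by apply: emeasurable_funD => //; apply: measurable_funeM; exact: measurable_sqr_grad.
  - apply: filterS w01 => x wx _; rewrite EFinM leeD2l// /Psi wx -EFinM lee_fin.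
    rewrite ler_piMr ?invr_ge0 ?(ltW e0)//.
    by case/andP: wx => ? ?; rewrite mulr_ile1// ?subr_ge0// gerBl.
rewrite ge0_integralD//; first last.
- by rewrite lee_fin invr_ge0 ltW.
- apply: measurable_funeM; exact: measurable_sqr_grad.
- by move=> x _; rewrite mule_ge0// lee_fin ?sqr_grad_ge0.
rewrite integral_cst// ge0_integralZl//; first last.
- by move=> x _; rewrite lee_fin sqr_grad_ge0.
- exact: measurable_sqr_grad.
rewrite lte_add_pinfty// lte_mul_pinfty// ?lee_fin ?invr_ge0 ?(ltW e0)//.
by apply: integrable_lty => //; exact: integrable_sqr_grad.
Qed.

(** The potential vanishes at 0 and 1, so only the gradient term is left; it
    decreases with eps. This makes the initial function a competitor whose
    energy is bounded uniformly in the course of the algorithm. *)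
Lemma energy_binary w : H1 w -> {ae mu, forall x, w x = 0 \/ w x = 1} ->
  exists2 D, 0 <= D & forall eps, 0 < eps -> energy eps w = (eps / 2 * D)%:E.
Proof.
move=> Hw w01; exists (\int[mu]_x sqr_grad w x).
  by rewrite fine_ge0// integral_ge0// => x _; rewrite lee_fin sqr_grad_ge0.
move=> eps e0; have e2 : 0 <= eps / 2 by rewrite divr_ge0 ?ltW.
rewrite /energy asboolT// EFinM fineK; last first.
  exact/integrable_fin_num/integrable_sqr_grad.
have ms := measurable_sqr_grad w.
rewrite -ge0_integralZl//; first last.
  by move=> x _; rewrite lee_fin sqr_grad_ge0.
apply: ge0_ae_eq_integral => //.
- exact: measurable_energy_density.
- exact: measurable_funeM.
- by move=> x _; exact: energy_density_ge0.
- by move=> x _; rewrite lee_fin mulr_ge0 ?sqr_grad_ge0.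
- apply: filterS w01 => x [] wx _; rewrite /Psi wx.
    by rewrite lexx ler01 mul0r mule0 adde0.
  by rewrite lexx ler01 subrr mulr0 mule0 adde0.
Qed.

(** The factor 1 + Delta is a crude bound for the square root of Delta. *)
Lemma dotL2_unit_valued_diff g u v G Delta :
  (lebesgue_rV (Omega : set 'rV[R]_d) <= Delta%:E)%E ->
  L2norm g <= G -> unit_valued u -> unit_valued v ->
  `|dotL2 Omega g (u - v)| <= G * (1 + Delta).
Proof.
move=> OD gG u01 v01; apply: le_trans (Cauchy_Schwarz _ _) _.
have := unit_valued_dist OD u01 v01.
have := L2norm_ge0 (u - v); have := L2norm_ge0 g.
move: (L2norm _) gG => a aG; move: (L2norm _) => b a0 b0 bD.
by apply: ler_pM => //; nra.
Qed.

End function_space_facts.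

(** * Subsequences below a bound *)

(** If u is infinitely often below C, pick these indices; otherwise u decreases
    from some index on, and its tail is bounded by the value there. *)
Lemma bounded_subsequence (R : realType) (u : nat -> R) (C : R) :
  (forall n, u n <= C \/ u n.+1 <= u n) ->
  exists C' (n : nat -> nat),
    [/\ 0 < C', {homo n : k l / (k < l)%N} & forall k, u (n k) <= C'].
Proof.
move=> step.
have [often|] := pselect (forall N, exists n, (N <= n)%N /\ u n <= C).
  have [f fP] := choice often.
  pose n k := iter k (f \o S) (f 0%N).
  exists (`|C| + 1), n; split; first by rewrite ltr_wpDl.
    apply: homo_ltn; first exact: ltn_trans.
    by move=> k; exact: (fP (n k).+1).1.
  have uC m : u (f m) <= `|C| + 1.
    by rewrite (le_trans (fP m).2)// (le_trans (ler_norm _))// lerDl.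
  by case=> [|k]; exact: uC.
move=> /existsNP[N /forallNP noC].
exists (`|u N| + 1), (addn N); split; first by rewrite ltr_wpDl.
  by move=> k l; rewrite ltn_add2l.
suff uN k : u (N + k)%N <= u N.
  by move=> k; rewrite (le_trans (uN k))// (le_trans (ler_norm _))// lerDl.
elim: k => [|k IH]; first by rewrite addn0.
have [uC|uS] := step (N + k)%N; last by rewrite addnS (le_trans uS).
by exfalso; apply: (noC (N + k)%N); rewrite leq_addr.
Qed.

(** * The merit value along the algorithm *)

Section trust_region_steps.
Context {R : realType} {d : nat} {Omega : lipschitz_domain R d}.
Local Notation mu := (domain_measure Omega).
Context (gamma : R) (gamma_gt0 : 0 < gamma).
Context (j : L2 Omega -> R) (gradj : L2 Omega -> L2 Omega).
Context (rho Delta0 r : R).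
Implicit Types (u v w : L2 Omega) (s : @state R d Omega).

Definition merit eps w : R := j w + gamma * fine (energy eps w).

Definition state_merit s := merit (st_eps s) (st_w s).

Lemma aredE w v eps : energy eps w \is a fin_num -> energy eps v \is a fin_num ->
  ared j gamma w v eps = (merit eps w - merit eps v)%:E.
Proof.
rewrite /ared /merit; case: (energy eps w) => // a _; case: (energy eps v) => // b _.
by rewrite /= -!EFinM -!EFinD; congr (_%:E); lra.
Qed.

(** The finiteness of E(v) must be derived: were it infinite, the reduction
    would be -oo. *)
Lemma ared_gt0 w v eps : 0 < eps -> energy eps w \is a fin_num ->
  (0%:E < ared j gamma w v eps)%E ->
  energy eps v \is a fin_num /\ merit eps v < merit eps w.
Proof.
move=> e0 Ew a0; have Ev : energy eps v \is a fin_num.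
  move: a0; rewrite ge0_fin_numE ?energy_ge0// /ared ltey.
  by apply: contraTneq => ->; rewrite gt0_muley ?lte_fin//= addeNy.
by split => //; move: a0; rewrite aredE// lte_fin subr_gt0.
Qed.

Lemma pred_reductionE flag eps w Delta wt :
  subproblem_minimizer flag gamma eps w (gradj w) Delta wt ->
  pred_reduction gradj gamma flag w Delta eps =
  (- subproblem_objective flag gamma eps w (gradj w) wt)%E.
Proof.
move=> [feas min]; congr (- _)%E; apply/eqP; rewrite eq_le; apply/andP; split.
  by apply: ereal_inf_lbound; exists wt.
by apply: le_ereal_inf_tmp => _ [v /min + <-].
Qed.

(** Let p be the predicted reduction. The actual one is at least
    p - (G (1 + Delta0) + 2 M), the subtracted term being a bound for the
    linearization error of j. If it is below rho p, then
    p <= (G (1 + Delta0) + 2 M) / (1 - rho); if it is at most K, then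
    p <= K + G (1 + Delta0) + 2 M. Both are covered by the first two summands
    of the bound. Testing the minimality of wt with the competitor v then
    gives gamma E(w) <= p + G (1 + Delta0) + gamma E(v). *)
Lemma rejected_merit_le (M G K E0 eps : R) w wt v :
  0 < rho < 1 -> 0 < eps -> 0 <= K ->
  (lebesgue_rV (Omega : set 'rV[R]_d) <= Delta0%:E)%E ->
  (forall u, unit_valued u -> `|j u| <= M) -> L2norm (gradj w) <= G ->
  unit_valued w -> H1 w -> unit_valued v -> (energy eps v <= E0%:E)%E ->
  subproblem_minimizer false gamma eps w (gradj w) Delta0 wt ->
  ~ ((rho%:E * pred_reduction gradj gamma false w Delta0 eps <=
        ared j gamma w wt eps)%E /\
     (K%:E < ared j gamma w wt eps)%E) ->
  merit eps w <=
    (G * (1 + Delta0) + 2 * M) / (1 - rho) + K + (M + G * (1 + Delta0)) +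
    gamma * E0.
Proof.
move=> /andP[rho0 rho1] e0 K0 OD jM gG w01 Hw v01 vE0 wtmin.
rewrite (pred_reductionE wtmin); move: wtmin => -[[_ wt01] wtmin] rej.
have mu_fin : (mu setT < +oo)%E.
  by rewrite domain_measure_setT (le_lt_trans OD)// ltry.
have := wtmin v (conj (unit_valued_dist OD v01 w01) v01).
have := dotL2_unit_valued_diff OD gG v01 w01.
have := dotL2_unit_valued_diff OD gG wt01 w01.
have := jM _ wt01; have := jM _ w01; move: rej.
have : energy eps v \is a fin_num.
  by rewrite ge0_fin_numE ?energy_ge0// (le_lt_trans vE0)// ltry.
have := energy_ge0 wt e0; have := energy_fin_num mu_fin e0 Hw w01.
rewrite /= /tr_objective /ared /merit.
move: (energy eps v) vE0 => [ev| |]// vE0; move: (energy eps w) => [ew| |]//.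
move: (energy eps wt) => [ewt| |]//; last first.
  by rewrite gt0_muley ?lte_fin.
move: (dotL2 _ _ (wt - w)) (dotL2 _ _ (v - w)) => dt dv _ _ _.
rewrite /= -!EFinM -!EFinD -?EFinN -?EFinM !lee_fin !lte_fin.
rewrite !ler_norml => rej /andP[j1 j2] /andP[j3 j4] /andP[d1 d2] /andP[d3 d4] opt.
(* Only real arithmetic is left: dt and dv are the values of the linear term at
   wt - w and v - w. *)
set D := G * _ in d1 d2 d3 d4 *; set P := (D + 2 * M) / (1 - rho).
have PE : P * (1 - rho) = D + 2 * M by rewrite divfK// gt_eqF// subr_gt0.
have E0v : gamma * ev <= gamma * E0 by rewrite ler_pM2l.
have DM : 0 <= D + 2 * M by lra.
have P0 : 0 <= P by rewrite divr_ge0// subr_ge0 ltW.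
suff : - (dt + gamma * ewt - gamma * ew) <= P + K by lra.
rewrite leNgt; apply/negP => lt; apply: rej; split; nra.
Qed.

(** Membership in H^1 and a.e. values in [0,1] are what keeps all energies
    finite. kappa and the minimal radius are bounded through their product since
    the acceptance test involves only that. *)
Definition admissible (eps0 K : R) s :=
  [/\ 0 < st_eps s <= eps0, 0 < st_kappa s * st_minDelta s <= K,
      unit_valued (st_w s) & H1 (st_w s)].

(** A phase with flag = 0 starts with radius Delta0 and does not survive an
    acceptance. Hence the radius can be smaller only after a rejection with
    radius Delta0, which bounds the merit value of the current iterate. *)
Definition phase_invariant (C : R) s :=
  st_flag s = false -> st_Delta s = Delta0 \/ state_merit s <= C.

(** eps changes only upon a rejection with flag = 0, and [phase_invariant] then
    bounds the merit value, directly or through the assumption on rejections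
    with radius Delta0. *)
Lemma algorithm_step_merit (eps0 K C : R) s s' :
  0 < rho < 1 -> 1 <= r ->
  (lebesgue_rV (Omega : set 'rV[R]_d) <= Delta0%:E)%E ->
  (forall wt, admissible eps0 K s -> st_flag s = false -> st_Delta s = Delta0 ->
    subproblem_minimizer false gamma (st_eps s) (st_w s) (gradj (st_w s))
      Delta0 wt ->
    ~ accepted j gradj gamma rho s wt -> state_merit s <= C) ->
  algorithm_step j gradj gamma rho Delta0 r s s' ->
  admissible eps0 K s -> phase_invariant C s ->
  [/\ admissible eps0 K s', phase_invariant C s' &
      state_merit s <= C \/ state_merit s' <= state_merit s].
Proof.
case: s => w Delta m eps kappa flag hrho r1 OD rejC [wt wtmin ->] adm inv.
have mu_fin : (mu setT < +oo)%E.
  by rewrite domain_measure_setT (le_lt_trans OD)// ltry.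
have [/= /andP[e0 ee0] /andP[km0 kmK] w01 Hw] := adm.
rewrite /next_state; case: asboolP => [[_ /= acc]|rej] /=.
  have Ew := energy_fin_num mu_fin e0 Hw w01.
  have a0 : (0%:E < ared j gamma w wt eps)%E.
    by apply: lt_trans acc; rewrite lte_fin.
  have [Ewt /ltW decr] := ared_gt0 e0 Ew a0.
  have Hwt := energy_fin_H1 Ewt; have wt01 := wtmin.1.2.
  (* [admissible] ignores the radius and the flag, here given dummy values. *)
  have adm' : admissible eps0 K (State wt 0 m eps kappa true).
    by split => //=; rewrite ?e0 ?km0.
  by case: ifP => _; split; (try by right); (try exact: adm'); move=> // _; left.
case: flag wtmin rej rejC adm inv => wtmin rej rejC adm inv /=.
  by case: ifP => _; split; (try by right); (try exact: adm); move=> // _; left.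
have meritC : merit eps w <= C.
  have [/= DD|//] := inv erefl.
  by rewrite DD in wtmin rej rejC adm; exact: (rejC wt).
case: ifP => _; last by split; [exact: adm|right|left].
(* The phase with flag = 0 ends: eps, kappa and the minimal radius decrease. *)
split=> //; last by left.
split => //; apply/andP; split => /=.
- by rewrite divr_gt0// (lt_le_trans ltr01).
- by rewrite (le_trans _ ee0)// ler_pdivrMr ?(lt_le_trans ltr01)// ler_peMr// ltW.
- by lra.
- by lra.
Qed.

End trust_region_steps.

Theorem proposition4p5 (R : realType) (d : nat) (hd : d = 2%N \/ d = 3%N)
  (Omega : lipschitz_domain R d) (gamma : R) (hgamma : 0 < gamma)
  (j : L2 Omega -> R) (gradj : L2 Omega -> L2 Omega)
  (hj : L2_invariant j) (hgradj : is_riesz_gradient j gradj)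
  (hjbound : exists M : R, forall w : L2 Omega,
     Linfty_unit_ball w -> `|j w| <= M)
  (hgradjbound : exists M : R, forall w : L2 Omega,
     Linfty_unit_ball w -> L2norm (gradj w) <= M)
  (rho Delta0 minDelta0 eps0 kappa0 r : R)
  (hrho : 0 < rho < 1) (hDelta0 : 0 < Delta0) (heps0 : 0 < eps0) (hr : 4 < r)
  (hkappa0 : 0 < kappa0 < rho) (hminDelta0 : 0 < minDelta0 < Delta0)
  (w0 : L2 Omega) (hw0 : H1 w0)
  (hw0_binary : {ae domain_measure Omega, forall x, w0 x = 0 \/ w0 x = 1})
  (s : nat -> @state R d Omega)
  (hs : algorithm_run j gradj gamma rho Delta0 minDelta0 eps0 kappa0 r w0 s)
  (hDelta0_large : (lebesgue_rV (Omega : set 'rV[R]_d) <= Delta0%:E)%E) :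
  exists (C : R) (n : nat -> nat),
    [/\ 0 < C, {homo n : k l / (k < l)%N} &
      (ereal_sup (range (fun k =>
         (j (st_w (s (n k))))%:E
         + gamma%:E * energy (st_eps (s (n k))) (st_w (s (n k))))) < C%:E)%E].
Proof.
have [M jM] := hjbound; have [G gG] := hgradjbound.
have [D D0 Ew0] := energy_binary hw0 hw0_binary.
have r1 : 1 <= r by rewrite (le_trans _ (ltW hr))// ler1n.
have w001 : unit_valued w0.
  by apply: filterS hw0_binary => x [] ->; rewrite lexx ler01.
have mu_fin : (domain_measure Omega setT < +oo)%E.
  by rewrite domain_measure_setT (le_lt_trans hDelta0_large)// ltry.
have [/andP[k0 _] /andP[m0 _]] := (hkappa0, hminDelta0).
pose K := kappa0 * minDelta0; have K0 : 0 < K by rewrite mulr_gt0.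
pose C := (G * (1 + Delta0) + 2 * M) / (1 - rho) + K + (M + G * (1 + Delta0)) +
    gamma * (eps0 / 2 * D).
have rejC s' wt : admissible eps0 K s' -> st_flag s' = false ->
    st_Delta s' = Delta0 ->
    subproblem_minimizer false gamma (st_eps s') (st_w s') (gradj (st_w s'))
      Delta0 wt ->
    ~ accepted j gradj gamma rho s' wt -> state_merit gamma j s' <= C.
  case: s' => w Delta m eps kappa flag.
  move=> [/= /andP[e0 ee0] /andP[km0 kmK] w01 Hw] -> -> wtmin rej.
  have vE0 : (energy eps w0 <= (eps0 / 2 * D)%:E)%E.
    by rewrite Ew0// lee_fin ler_wpM2r// ler_pM2r// invr_gt0.
  have jM' u : unit_valued u -> `|j u| <= M by move/unit_valued_Linfty/jM.
  have := @rejected_merit_le _ _ _ _ hgamma _ _ _ _ _ _ _ _ _ _ _ _ hrho e0 (ltW km0)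
    hDelta0_large jM' (gG _ (unit_valued_Linfty w01)) w01 Hw w001 vE0 wtmin rej.
  by rewrite /state_merit /C /=; lra.
have inv n : admissible eps0 K (s n) /\ phase_invariant gamma j Delta0 C (s n).
  elim: n => [|n [adm pinv]].
    by rewrite hs.1; split => //; split => //=; rewrite ?heps0 ?K0 lexx.
  by have [] := algorithm_step_merit hgamma hrho r1 hDelta0_large
    (rejC (s n)) (hs.2 n) adm pinv.
have step n : state_merit gamma j (s n) <= C \/
    state_merit gamma j (s n.+1) <= state_merit gamma j (s n).
  have [adm pinv] := inv n.
  by have [] := algorithm_step_merit hgamma hrho r1 hDelta0_large
    (rejC (s n)) (hs.2 n) adm pinv.
have [C' [nk [C'0 nkS nkC']]] := bounded_subsequence step.
exists (C' + 1), nk; split => //; first by rewrite ltr_wpDr.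
apply: (@le_lt_trans _ _ C'%:E); last by rewrite lte_fin ltrDl.
apply: ge_ereal_sup => _ [k _ <-].
have [[/andP[e0 _] _ w01 Hw] _] := inv (nk k).
rewrite -(fineK (energy_fin_num mu_fin e0 Hw w01)) -EFinM -EFinD lee_fin.
exact: nkC'.
Qed.
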